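(* If $D$ is a countable sharp domain, then $D$ is a Dedekind domain.
   Context: All rings are integral domains (commutative, unitary, without zero-divisors). A domain $D$ is called a sharp domain if whenever $I \supseteq AB$ with $I, A, B$ nonzero ideals of $D$, there exist ideals $A' \supseteq A$ and $B' \supseteq B$ of $D$ such that $I = A'B'$. A Dedekind domain is a domain in which every nonzero ideal is invertible; fields are regarded as Dedekind domains. *)

(* Defs.v *)
From mathcomp Require Import all_boot all_algebra.
From mathcomp Require Import boolp classical_sets functions cardinality.

Set Implicit Arguments.
Unset Strict Implicit.
Unset Printing Implicit Defensive.

Import GRing.Theory.
Local Open Scope classical_set_scope.
Local Open Scope ring_scope.

(* MathComp's [idealr_closed] also requires [1 \notin I]; here, as usual in
   multiplicative ideal theory, the unit ideal [setT] is an ideal as well. *)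
Definition is_ideal (D : idomainType) (I : set D) : Prop :=
  [/\ I 0,
      forall x y, I x -> I y -> I (x + y) &
      forall a x, I x -> I (a * x)].

Definition nonzero_ideal (D : idomainType) (I : set D) : Prop :=
  is_ideal I /\ I <> [set 0].

(* Used both for ideals of a domain and for submodules of its fraction
   field. *)
Definition prod_ideal (R : comNzRingType) (A B : set R) : set R :=
  [set x | exists n (a b : 'I_n -> R),
    [/\ forall i, A (a i), forall i, B (b i) & x = \sum_(i < n) a i * b i]].

Definition fractional_ideal (D : idomainType) (J : set {fraction D}) : Prop :=
  [/\ J 0,
      forall x y, J x -> J y -> J (x + y),
      forall (a : D) x, J x -> J (tofrac a * x) &
      exists2 d : D, d != 0 &
        forall x, J x -> range (@tofrac D) (tofrac d * x)].

Definition invertible_ideal (D : idomainType) (I : set D) : Prop :=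
  exists2 J : set {fraction D}, fractional_ideal J &
    prod_ideal (@tofrac D @` I) J = range (@tofrac D).

Definition dedekind_domain (D : idomainType) : Prop :=
  forall I : set D, nonzero_ideal I -> invertible_ideal I.

Definition sharp_domain (D : idomainType) : Prop :=
  forall I A B : set D,
    nonzero_ideal I -> nonzero_ideal A -> nonzero_ideal B ->
    prod_ideal A B `<=` I ->
    exists A' B' : set D,
      [/\ is_ideal A', is_ideal B', A `<=` A', B `<=` B' &
          I = prod_ideal A' B'].

(* Main.v *)
Require Import Defs.
From mathcomp Require Import all_boot all_algebra.
From mathcomp Require Import boolp classical_sets functions cardinality.
From mathcomp Require Import ring.

(** Write [S_v] for the divisorial closure of [S]. Sharpness makes the
    divisorial closure of every nonzero ideal invertible
    ([sharp_vclosure_invertible]), so a nonzero ideal [I] factors as [I_v J]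
    with [J_v = D]. If [J] were proper, it would lie in a prime ideal [M]
    with [M_v = D], that is, in a prime contained in no proper invertible ideal.
    Countability excludes such primes, hence [J = D] and [I = I_v] is
    invertible.

    Two facts are behind this exclusion. The first is that [(x, y)_v] lies in
    [M] as soon as [x] and [y] do ([sharp_vclosure_pair]). A factorization of
    [(x, y^2)], which contains [(x, y)^2], is compared locally at [M] with the
    general fact that a product of two ideals cannot be generated by two
    elements unless one factor contains a local common divisor of them
    ([two_generated_factor]). As invertible ideals are locally principal, it
    follows that an invertible ideal inside [M] can be enlarged to another one
    inside [M] that contains any given element of [M].

    The second is a Baire argument. Since no proper invertible ideal contains
    [M], there is always room to enlarge, and this splits any invertible ideal
    inside [M] enough to find two disjoint intervals of invertible ideals inside
    a given one ([dense_prime_split]). There are only countably many invertible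
    ideals, these being finitely generated, but an intersection of a nested
    sequence of them that contains a nonzero element is again invertible.
    Cantor's nested intervals then produce an invertible ideal outside any
    enumeration ([no_dense_prime]).

    The whole argument is carried out inside the domain: an inverse fractional
    ideal is represented by an integral ideal and a denominator, and local
    statements at [M] by multipliers outside [M]. *)

Set Implicit Arguments.
Unset Strict Implicit.
Unset Printing Implicit Defensive.

Import GRing.Theory.
Local Open Scope classical_set_scope.
Local Open Scope ring_scope.

(** * Ideals and their products *)

Section Ideals.
Variable D : idomainType.
Implicit Types (I J A B C E G S M V X : set D) (a b c d p q x y z : D).

Lemma ideal0 I : is_ideal I -> I 0. Proof. by case. Qed.

Lemma idealD I x y : is_ideal I -> I x -> I y -> I (x + y).
Proof. by case=> _ + _; apply. Qed.

Lemma idealMl I a x : is_ideal I -> I x -> I (a * x).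
Proof. by case=> _ _; apply. Qed.

Lemma idealMr I a x : is_ideal I -> I x -> I (x * a).
Proof. by rewrite mulrC; apply: idealMl. Qed.

Lemma idealB I x y : is_ideal I -> I x -> I y -> I (x - y).
Proof.
by move=> iI Ix Iy; rewrite -mulN1r; apply: idealD => //; apply: idealMl.
Qed.

Lemma ideal_sum I n (f : 'I_n -> D) :
  is_ideal I -> (forall i, I (f i)) -> I (\sum_(i < n) f i).
Proof.
move=> iI If; apply: (big_ind I) => //; first exact: ideal0.
by move=> x y Ix Iy; apply: idealD.
Qed.

Definition principal d : set D := [set a | exists r, a = r * d].

Lemma principal_ideal d : is_ideal (principal d).
Proof.
split.
- by exists 0; rewrite mul0r.
- by move=> x y [r ->] [s ->]; exists (r + s); rewrite mulrDl.
- by move=> a x [r ->]; exists (a * r); rewrite mulrA.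
Qed.

Lemma principal_id d : principal d d.
Proof. by exists 1; rewrite mul1r. Qed.

Definition pair_ideal p q : set D := [set z | exists r s, z = r * p + s * q].

Lemma pair_ideal_ideal p q : is_ideal (pair_ideal p q).
Proof.
split.
- by exists 0, 0; rewrite !mul0r addr0.
- by move=> x y [r [s ->]] [r' [s' ->]]; exists (r + r'), (s + s'); ring.
- by move=> a x [r [s ->]]; exists (a * r), (a * s); ring.
Qed.

Lemma pair_ideal_l p q : pair_ideal p q p.
Proof. by exists 1, 0; ring. Qed.

Lemma pair_ideal_r p q : pair_ideal p q q.
Proof. by exists 0, 1; ring. Qed.

Lemma nonzero_idealI I x : is_ideal I -> I x -> x != 0 -> nonzero_ideal I.
Proof.
by move=> iI Ix x0; split=> // I0; move: Ix x0; rewrite I0 => ->; rewrite eqxx.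
Qed.

Lemma nonzero_idealE I : nonzero_ideal I -> exists2 x, I x & x != 0.
Proof.
move=> [iI I0]; apply: contrapT => nex; apply: I0; apply/seteqP; split=> x /=.
  by move=> Ix; apply: contrapT => /eqP x0; apply: nex; exists x.
by move=> ->; apply: ideal0.
Qed.

Lemma prod_mem A B a b : A a -> B b -> prod_ideal A B (a * b).
Proof.
move=> Aa Bb; exists 1, (fun=> a), (fun=> b); split=> //.
by rewrite big_ord1.
Qed.

Lemma prod_sub A B X : is_ideal X ->
  (forall a b, A a -> B b -> X (a * b)) -> prod_ideal A B `<=` X.
Proof.
move=> iX ABX _ [n [a [b [Aa Bb ->]]]]; apply: ideal_sum => // i.
exact: ABX.
Qed.

Lemma prod_is_ideal A B : is_ideal A -> is_ideal (prod_ideal A B).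
Proof.
move=> iA; split.
- by exists 0, (fun=> 0), (fun=> 0); split=> [[]|[]|] //; rewrite big_ord0.
- move=> _ _ [n [a [b [Aa Bb ->]]]] [m [a' [b' [Aa' Bb' ->]]]].
  pose glue (f : 'I_n -> D) (g : 'I_m -> D) (k : 'I_(n + m)) :=
    match fintype.split k with inl i => f i | inr j => g j end.
  exists (n + m)%N, (glue a a'), (glue b b'); split.
  + by move=> k; rewrite /glue; case: (fintype.split k).
  + by move=> k; rewrite /glue; case: (fintype.split k).
  + rewrite big_split_ord /=; congr (_ + _); apply: eq_bigr => i _.
      by rewrite /glue (unsplitK (inl i : 'I_n + 'I_m)).
    by rewrite /glue (unsplitK (inr i : 'I_n + 'I_m)).
- move=> c _ [n [a [b [Aa Bb ->]]]].
  exists n, (fun i => c * a i), b; split=> // [i|]; first exact: idealMl.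
  by rewrite mulr_sumr; apply: eq_bigr => i _; rewrite mulrA.
Qed.

Lemma prod_subl A B : is_ideal A -> prod_ideal A B `<=` A.
Proof. by move=> iA; apply: prod_sub => // a b Aa _; apply: idealMr. Qed.

Lemma prod_subr A B : is_ideal B -> prod_ideal A B `<=` B.
Proof. by move=> iB; apply: prod_sub => // a b _; apply: idealMl. Qed.

Lemma prod_mono A B A' B' : is_ideal A' -> A `<=` A' -> B `<=` B' ->
  prod_ideal A B `<=` prod_ideal A' B'.
Proof.
move=> iA' sA sB; apply: prod_sub; first exact: prod_is_ideal.
by move=> a b /sA ? /sB ?; apply: prod_mem.
Qed.

(** The ideal of those [z] with [e z] in [d G], that is [(d / e) G] cut down
    to the domain; denominators are cleared with it throughout. *)
Definition scaled_colon e d G : set D :=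
  [set z | exists2 g, G g & e * z = d * g].

Lemma scaled_colon_ideal e d G : is_ideal G -> is_ideal (scaled_colon e d G).
Proof.
move=> iG; split.
- by exists 0; [exact: ideal0|rewrite !mulr0].
- move=> x y [g Gg xg] [h Gh yh]; exists (g + h); first exact: idealD.
  by rewrite !mulrDr xg yh.
- move=> a x [g Gg xg]; exists (a * g); first exact: idealMl.
  by rewrite mulrCA xg mulrCA.
Qed.

Definition colon A B : set D := [set z | forall b, B b -> A (z * b)].

Lemma colon_ideal A B : is_ideal A -> is_ideal (colon A B).
Proof.
move=> iA; split.
- by move=> b _; rewrite mul0r; apply: ideal0.
- by move=> x y Ax Ay b Bb; rewrite mulrDl; apply: idealD; [|exact: Ax|exact: Ay].
- by move=> a x Ax b Bb; rewrite -mulrA; apply: idealMl => //; apply: Ax.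
Qed.

Lemma prod_idealC A B : prod_ideal A B = prod_ideal B A.
Proof.
by apply/seteqP; split=> _ [n [a [b [Aa Bb ->]]]]; exists n, b, a; split=> //;
  apply: eq_bigr => i _; rewrite mulrC.
Qed.

Lemma prod_idealA A B C : is_ideal A -> is_ideal B ->
  prod_ideal A (prod_ideal B C) = prod_ideal (prod_ideal A B) C.
Proof.
move=> iA iB; have iAB := prod_is_ideal B iA; apply/seteqP; split.
- apply: prod_sub; first exact: prod_is_ideal.
  move=> a u Aa; rewrite mulrC; move: u.
  suff : prod_ideal B C `<=` colon (prod_ideal (prod_ideal A B) C) [set a].
    by move=> + u => /[apply]; apply.
  apply: prod_sub; first by apply: colon_ideal; apply: prod_is_ideal.
  move=> b c Bb Cc _ ->; rewrite mulrC mulrA.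
  by apply: prod_mem => //; apply: prod_mem.
- apply: prod_sub; first exact: prod_is_ideal.
  move=> u c + Cc; move: u.
  suff : prod_ideal A B `<=` colon (prod_ideal A (prod_ideal B C)) [set c].
    by move=> + u => /[apply]; apply.
  apply: prod_sub; first by apply: colon_ideal; apply: prod_is_ideal.
  move=> a b Aa Bb _ ->; rewrite -mulrA.
  by apply: prod_mem => //; apply: prod_mem.
Qed.

(** * Invertible ideals *)

(** Invertibility with the denominator cleared: [B / d] is the inverse
    fractional ideal of [V]. *)
Definition inverse_over d V B : Prop :=
  [/\ is_ideal V, is_ideal B, d != 0 & prod_ideal V B = principal d].

Definition cleared_invertible V : Prop := exists B d, inverse_over d V B.

Lemma invertible_is_ideal V : cleared_invertible V -> is_ideal V.
Proof. by move=> [B [d []]]. Qed.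

Lemma inverse_over_mem d V B v b :
  inverse_over d V B -> V v -> B b -> exists r, v * b = r * d.
Proof.
by move=> [_ _ _ VB] Vv Bb; have := prod_mem Vv Bb; rewrite VB.
Qed.

Lemma cleared_invertibleI V : cleared_invertible V -> invertible_ideal V.
Proof.
move=> [B [d [iV iB d0 VB]]].
have dF0 : tofrac d != 0 by rewrite tofrac_eq0.
exists [set y | exists2 b, B b & y = tofrac b / tofrac d].
  split.
  - by exists 0; [exact: ideal0|rewrite tofrac0 mul0r].
  - move=> _ _ [b Bb ->] [c Bc ->]; exists (b + c); first exact: idealD.
    by rewrite tofracD mulrDl.
  - move=> a _ [b Bb ->]; exists (a * b); first exact: idealMl.
    by rewrite tofracM mulrA.
  - exists d => // _ [b Bb ->]; exists b => //.
    by rewrite mulrCA divff ?mulr1.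
apply/seteqP; split.
- move=> _ [n [a [b [Va Bb ->]]]].
  apply: (big_ind (range (@tofrac D))).
  + by exists 0; rewrite ?tofrac0.
  + by move=> _ _ [x _ <-] [y _ <-]; exists (x + y); rewrite ?tofracD.
  move=> i _; have [v Vv <-] := Va i; have [c Bc ->] := Bb i.
  have [//|r vc] := @inverse_over_mem d V B v c _ Vv Bc.
  by exists r => //; rewrite mulrA -tofracM vc tofracM mulfK.
- move=> _ [r _ <-].
  have [n [a [b [Va Bb dE]]]] : prod_ideal V B d by rewrite VB; exact: principal_id.
  exists n, (fun i => tofrac (r * a i)), (fun i => tofrac (b i) / tofrac d).
  split=> [i|i|]; first by exists (r * a i) => //; apply: idealMl.
    by exists (b i).
  apply: (mulIf dF0); rewrite -tofracM {1}dE mulr_suml mulr_sumr rmorph_sum /=.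
  by apply: eq_bigr => i _; rewrite -[RHS]mulrA divfK // -tofracM mulrA.
Qed.

(** Multiplying [e] by the inverse [B / d] and then by [V] gives [e] back:
    this is how membership in an ideal is tested through an inverse. *)
Lemma inverse_over_elim d V B e G : inverse_over d V B -> is_ideal G ->
  (forall v b, V v -> B b -> scaled_colon e d G (v * b)) -> G e.
Proof.
move=> [iV iB d0 VB] iG VBG.
have := prod_sub (scaled_colon_ideal e d iG) VBG; rewrite VB.
move=> /(_ _ (principal_id d)) [g Gg]; rewrite mulrC => /(mulfI d0).
by move=> ->.
Qed.

Lemma invertible_cancel V E G : cleared_invertible V -> is_ideal G ->
  prod_ideal V E `<=` prod_ideal V G -> E `<=` G.
Proof.
move=> [B [d VB]] iG VEG e Ee; apply: (inverse_over_elim VB iG) => v b Vv Bb.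
have iX : is_ideal (scaled_colon b d G) by exact: scaled_colon_ideal.
have [|g Gg bveg] := prod_sub iX _ (VEG _ (prod_mem Vv Ee)).
  move=> w g Vw Gg; have [r wb] := inverse_over_mem VB Vw Bb.
  by exists (r * g); [exact: idealMl|rewrite mulrA (mulrC b) wb; ring].
by exists g => //; rewrite -bveg; ring.
Qed.

Lemma invertible_principal x : x != 0 -> cleared_invertible (principal x).
Proof.
move=> x0; exists setT, x; split=> //; first exact: principal_ideal.
apply/seteqP; split; first by apply: prod_subl; exact: principal_ideal.
move=> _ [r ->]; rewrite mulrC; apply: prod_mem => //; exact: principal_id.
Qed.

Lemma invertible_setT : cleared_invertible [set: D].
Proof.
suff -> : [set: D] = principal 1 by apply: invertible_principal; exact: oner_neq0.
by apply/seteqP; split=> // x _; exists x; rewrite mulr1.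
Qed.

Lemma invertible_prod V E :
  cleared_invertible V -> cleared_invertible E ->
  cleared_invertible (prod_ideal V E).
Proof.
move=> [B [d [iV iB d0 VB]]] [H [e [iE iH e0 EH]]].
exists (prod_ideal H B), (d * e); split.
- exact: prod_is_ideal.
- exact: prod_is_ideal.
- exact: mulf_neq0.
rewrite -prod_idealA // (prod_idealA B iE iH) EH prod_idealC -prod_idealA //; last first.
  exact: principal_ideal.
rewrite (prod_idealC B) VB; apply/seteqP; split.
- apply: prod_sub; first exact: principal_ideal.
  by move=> _ _ [r ->] [s ->]; exists (r * s); ring.
- move=> _ [r ->]; have -> : r * (d * e) = (r * e) * d by ring.
  by apply: prod_mem; [exists r|exact: principal_id].
Qed.

Lemma invertible_factor E G : is_ideal E -> is_ideal G ->
  cleared_invertible (prod_ideal E G) -> cleared_invertible G.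
Proof.
move=> iE iG [H [d [_ iH d0 EGH]]].
exists (prod_ideal E H), d; split=> //; first exact: prod_is_ideal.
by rewrite prod_idealA // (prod_idealC G).
Qed.

(** To contain is to divide, for an invertible ideal. *)
Lemma prod_colon C E : cleared_invertible E -> is_ideal C -> C `<=` E ->
  C = prod_ideal E (colon C E).
Proof.
move=> [B [x EB]] iC CE; have iE : is_ideal E by case: EB.
have iK : is_ideal (prod_ideal E (colon C E)) by exact: prod_is_ideal.
apply/seteqP; split; last first.
  by apply: prod_sub => // e z Ee; rewrite mulrC; apply.
have x0 : x != 0 by case: EB.
move=> c Cc; apply: (inverse_over_elim EB iK) => e b Ee Bb.
have [z cb] := inverse_over_mem EB (CE _ Cc) Bb.
exists (e * z); last by rewrite mulrCA cb; ring.
apply: prod_mem => // e' Ee'; have [r eb] := inverse_over_mem EB Ee' Bb.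
suff -> : z * e' = r * c by apply: idealMl.
apply: (mulfI x0).
have -> : x * (z * e') = (z * x) * e' by ring.
by rewrite -cb -mulrA (mulrC b) eb; ring.
Qed.

(** * Divisorial closure *)

(** The divisorial closure [(S^-1)^-1] of [S], phrased by saying that a
    fraction [c / d] which multiplies [S] into the domain also multiplies [a]
    into it. *)
Definition vclosure S : set D :=
  [set a | forall c d, d != 0 -> (forall s, S s -> principal d (c * s)) ->
    principal d (c * a)].

Lemma vclosure_ideal S : is_ideal (vclosure S).
Proof.
split.
- by move=> c d _ _; rewrite mulr0; apply: ideal0; exact: principal_ideal.
- move=> x y Sx Sy c d d0 cS; rewrite mulrDr.
  by apply: idealD; [exact: principal_ideal|exact: Sx|exact: Sy].
- move=> a x Sx c d d0 cS; rewrite mulrCA.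
  by apply: idealMl; [exact: principal_ideal|exact: Sx].
Qed.

Lemma sub_vclosure S : S `<=` vclosure S.
Proof. by move=> s Ss c d _; apply. Qed.

Lemma vclosure_sub_invertible S V :
  cleared_invertible V -> S `<=` V -> vclosure S `<=` V.
Proof.
move=> [B [d VB]] SV a Sa; have [iV iB d0 _] := VB.
apply: (inverse_over_elim VB iV) => v b Vv Bb.
have [s Ss|r ba] := Sa b d d0.
  by rewrite mulrC; have [r ->] := inverse_over_mem VB (SV _ Ss) Bb; exists r.
by exists (r * v); [exact: idealMl|rewrite mulrCA mulrC (mulrC a) ba; ring].
Qed.

Lemma vclosure_mono S M : S `<=` M -> vclosure S `<=` vclosure M.
Proof. by move=> SM a Sa c d d0 cM; apply: Sa => // s /SM; apply: cM. Qed.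

(** * Prime ideals and two-generated products *)

Definition prime_ideal M : Prop :=
  [/\ is_ideal M, ~ M 1 & forall a b, M (a * b) -> M a \/ M b].

Lemma prime_notinM M a b : prime_ideal M -> ~ M a -> ~ M b -> ~ M (a * b).
Proof. by move=> [_ _ pM] nMa nMb /pM []. Qed.

Lemma ideal_in_prime J : is_ideal J -> ~ J 1 ->
  exists2 M, prime_ideal M & J `<=` M.
Proof.
move=> iJ nJ1.
(* The empty set is admitted because it is the union of the empty chain. *)
pose P S := S = set0 \/ [/\ is_ideal S, J `<=` S & ~ S 1].
have [F FP totF|M [PM maxM]] := @Zorn_bigcup D P.
  have [F0|] := pselect (forall S, F S -> S = set0).
    by left; apply/seteqP; split=> // x [S /F0 ->].
  move=> /existsNP [S0 /not_implyP [FS0 S0n]]; right.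
  have FI S x : F S -> S x -> [/\ is_ideal S, J `<=` S & ~ S 1].
    by move=> /FP [->|].
  have [S0i JS0 S01] : [/\ is_ideal S0, J `<=` S0 & ~ S0 1].
    by have [] := FP _ FS0.
  split.
  - split.
    + by exists S0 => //; exact: ideal0.
    + move=> x y [S FS Sx] [T FT Ty].
      have [Si _ _] := FI _ _ FS Sx; have [Ti _ _] := FI _ _ FT Ty.
      have [ST|TS] := totF _ _ FS FT.
        by exists T => //; apply: idealD => //; exact: ST.
      by exists S => //; apply: idealD => //; exact: TS.
    + move=> a x [S FS Sx]; exists S => //.
      by have [Si _ _] := FI _ _ FS Sx; exact: idealMl.
  - by move=> x Jx; exists S0 => //; exact: JS0.
  - by move=> [S FS S1]; have [] := FI _ _ FS S1.
have {PM} [iM JM nM1] : [/\ is_ideal M, J `<=` M & ~ M 1].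
  case: PM => // M0; exfalso; apply: (maxM J); last by right; split.
  rewrite M0; split=> // J0; exact: (J0 0 (ideal0 iJ)).
exists M => //; split=> // a b Mab.
have [Ma|nMa] := pselect (M a); first by left.
right; pose N : set D := [set z | exists m r, M m /\ z = m + r * a].
have iN : is_ideal N.
  split.
  - by exists 0, 0; split; [exact: ideal0|ring].
  - move=> _ _ [m [r [Mm ->]]] [n [s [Mn ->]]]; exists (m + n), (r + s).
    by split; [exact: idealD|ring].
  - move=> c _ [m [r [Mm ->]]]; exists (c * m), (c * r).
    by split; [exact: idealMl|ring].
have MN : M `<=` N by move=> m Mm; exists m, 0; split=> //; ring.
have [m [r [Mm oneE]]] : N 1.
  apply: contrapT => nN1; apply: (maxM N).
    split=> // NM; apply/nMa/NM; exists 0, 1.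
    by split; [exact: ideal0|ring].
  by right; split=> // x /JM/MN.
have -> : b = b * m + r * (a * b) by rewrite -{1}(mulr1 b) oneE; ring.
by apply: idealD => //; exact: idealMl.
Qed.

Section Products.
Variables (M A B : set D) (p q : D).
Hypotheses (pM : prime_ideal M) (iA : is_ideal A) (iB : is_ideal B).
Hypothesis ABpq : prod_ideal A B = pair_ideal p q.

Let iM : is_ideal M. Proof. by case: pM. Qed.

Let prodE a b : A a -> B b -> exists r s, a * b = r * p + s * q.
Proof. by move=> Aa Bb; have := prod_mem Aa Bb; rewrite ABpq. Qed.

Let factor_gens S : (S = A \/ S = B) -> S p /\ S q.
Proof.
have pAB : prod_ideal A B p by rewrite ABpq; exact: pair_ideal_l.
have qAB : prod_ideal A B q by rewrite ABpq; exact: pair_ideal_r.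
by case=> ->; split; [apply: (prod_subl iA pAB)|apply: (prod_subl iA qAB)|
  apply: (prod_subr iB pAB)|apply: (prod_subr iB qAB)].
Qed.

(** Localize at [M] and suppose that no element of [A] or [B] divides both [p]
    and [q]. Then [p, q] is a basis of the reduction of [A B] modulo [M], a
    plane over the residue field, and multiplication by a fixed element of [A]
    or of [B] never has rank two there, by Cramer's rule. But a bilinear map
    whose partial maps all have rank at most one spans at most a line: if
    [a1 b1] and [a2 b2] were independent, [a1 b2] and [a2 b1] would lie on both
    of their lines, hence vanish, and multiplication by [a1 + a2] would send
    [b1, b2] to a basis. *)
Lemma two_generated_factor : exists a t,
  [/\ A a \/ B a, ~ M t, principal a (t * p) & principal a (t * q)].
Proof.
apply: contrapT => nodiv.
have {}nodiv a t : A a \/ B a -> principal a (t * p) -> principal a (t * q) ->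
    M t.
  by move=> ABa tp tq; apply: contrapT => nMt; apply: nodiv; exists a, t.
have indep r s : r * p + s * q = 0 -> M r /\ M s.
  have [Ap Aq] := factor_gens (or_introl erefl).
  move=> rs0; split.
    apply: (nodiv q); [by left|exists (- s)|by exists r].
    by rewrite mulNr; apply/eqP; rewrite -addr_eq0 rs0.
  apply: (nodiv p); [by left|by exists s|exists (- r)].
  by rewrite mulNr; apply/eqP; rewrite -addr_eq0 addrC rs0.
have cramer a b b' r s r' s' : A a \/ B a ->
    a * b = r * p + s * q -> a * b' = r' * p + s' * q -> M (r * s' - r' * s).
  move=> ABa e e'; apply: (nodiv a) => //.
  - exists (s' * b - s * b').
    have -> : (s' * b - s * b') * a = s' * (a * b) - s * (a * b') by ring.
    by rewrite e e'; ring.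
  - exists (r * b' - r' * b).
    have -> : (r * b' - r' * b) * a = r * (a * b') - r' * (a * b) by ring.
    by rewrite e e'; ring.
have det a b a' b' r s r' s' : A a -> B b -> A a' -> B b' ->
    a * b = r * p + s * q -> a' * b' = r' * p + s' * q -> M (r * s' - r' * s).
  move=> Aa Bb Aa' Bb' e e'.
  have [u [v f]] := prodE Aa Bb'; have [u' [v' f']] := prodE Aa' Bb.
  have d1 : M (r * v - u * s) by apply: (cramer a _ _ _ _ _ _ _ e f); left.
  have d2 : M (u * s' - r' * v).
    by apply: (cramer b' a a'); rewrite 1?mulrC //; right.
  have d3 : M (r * v' - u' * s).
    by apply: (cramer b a a'); rewrite 1?mulrC //; right.
  have d4 : M (u' * s' - r' * v') by apply: (cramer a' _ _ _ _ _ _ _ f' e'); left.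
  have d5 : M ((r + u') * (v + s') - (u + r') * (s + v')).
    apply: (cramer (a + a') b b'); first by left; exact: idealD.
    - by rewrite mulrDl e f'; ring.
    - by rewrite mulrDl f e'; ring.
  set dt := r * s' - r' * s.
  have sum_in : M (dt + (u' * v - u * v')).
    have -> : dt + (u' * v - u * v') = (r + u') * (v + s') - (u + r') * (s + v')
      - (r * v - u * s) - (u' * s' - r' * v') by rewrite /dt; ring.
    by apply: idealB => //; apply: idealB.
  (* the Plücker relation between the four products *)
  have prod_in : M (dt * (u' * v - u * v')).
    have -> : dt * (u' * v - u * v') =
        (r * v' - u' * s) * (u * s' - r' * v) * (-1) +
        (r * v - u * s) * (u' * s' - r' * v') by rewrite /dt; ring.
    by apply: idealD => //; apply: idealMr => //; apply: idealMr.
  have : M (dt * dt).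
    have -> : dt * dt = dt * (dt + (u' * v - u * v')) - dt * (u' * v - u * v').
      by ring.
    by apply: idealB => //; apply: idealMl.
  by case: pM => _ _ /[apply] -[].
have fst_in a b r s : A a -> B b -> a * b = r * p + s * q -> M r.
  move=> Aa Bb e.
  pose X : set D := [set z | exists r' s',
    z = r' * p + s' * q /\ M (r * s' - r' * s)].
  have iX : is_ideal X.
    split.
    - by exists 0, 0; split; rewrite ?mulr0 ?mul0r ?addr0 ?subr0; [|exact: ideal0].
    - move=> _ _ [r1 [s1 [-> M1]]] [r2 [s2 [-> M2]]].
      exists (r1 + r2), (s1 + s2); split; first by ring.
      have -> : r * (s1 + s2) - (r1 + r2) * s =
        (r * s1 - r1 * s) + (r * s2 - r2 * s) by ring.
      exact: idealD.
    - move=> c _ [r1 [s1 [-> M1]]]; exists (c * r1), (c * s1); split; first by ring.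
      have -> : r * (c * s1) - c * r1 * s = c * (r * s1 - r1 * s) by ring.
      exact: idealMl.
  have [r' [s' [qE Mdt]]] : X q.
    have := pair_ideal_r p q; rewrite -ABpq; apply: prod_sub => //.
    move=> a' b' Aa' Bb'; have [r' [s' e']] := prodE Aa' Bb'.
    by exists r', s'; split=> //; exact: (det a b a' b').
  have [|Mr' Ms'] := indep r' (s' - 1).
    by rewrite mulrBl mul1r addrA -qE subrr.
  have -> : r = (r * s' - r' * s) + s * r' - r * (s' - 1) by ring.
  by apply: idealB; [|apply: idealD => //; exact: idealMl|exact: idealMl].
pose Y : set D := [set z | exists r s, z = r * p + s * q /\ M r].
have iY : is_ideal Y.
  split.
  - by exists 0, 0; split; [ring|exact: ideal0].
  - move=> _ _ [r1 [s1 [-> M1]]] [r2 [s2 [-> M2]]].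
    by exists (r1 + r2), (s1 + s2); split; [ring|exact: idealD].
  - move=> c _ [r1 [s1 [-> M1]]].
    by exists (c * r1), (c * s1); split; [ring|exact: idealMl].
have [r [s [pE Mr]]] : Y p.
  have := pair_ideal_l p q; rewrite -ABpq; apply: prod_sub => //.
  move=> a b Aa Bb; have [r [s e]] := prodE Aa Bb.
  by exists r, s; split=> //; exact: (fst_in a b r s).
have [|Mr1 _] := indep (r - 1) s.
  by rewrite mulrBl mul1r addrAC -pE subrr.
case: pM => _ nM1 _; apply: nM1.
have -> : 1 = r - (r - 1) :> D by ring.
exact: idealB.
Qed.

End Products.

Lemma invertible_nonzero V : cleared_invertible V -> nonzero_ideal V.
Proof.
move=> [B [d [iV iB d0 VB]]]; apply: (nonzero_idealI iV _ d0).
by apply: (prod_subl (B := B) iV); rewrite VB; exact: principal_id.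
Qed.

(** Locally at [M] the unit ideal is [C C^-1], so some product of an element [c]
    of [C] and one of the inverse is a local unit, and then [c] generates [C]. *)
Lemma invertible_locally_principal M C : prime_ideal M -> cleared_invertible C ->
  exists c s, [/\ C c, ~ M s & forall z, C z -> principal c (s * z)].
Proof.
move=> [iM nM1 pM] [B [d CB]]; apply: contrapT => nloc; apply: nM1.
have d0 : d != 0 by case: CB.
apply: (inverse_over_elim CB iM) => c b Cc Bb.
have [s cb] := inverse_over_mem CB Cc Bb.
exists s; last by rewrite mul1r cb mulrC.
apply: contrapT => nMs; apply: nloc; exists c, s; split=> // z Cz.
have [r zb] := inverse_over_mem CB Cz Bb; exists r.
apply: (mulIf d0).
have -> : s * z * d = (s * d) * z by ring.
have -> : r * c * d = (r * d) * c by ring.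
by rewrite -cb -zb; ring.
Qed.

(** * Consequences of sharpness *)

Section Sharp.
Hypothesis D_sharp : sharp_domain D.

(** Sharpness is applied to [S ((x) : S)] inside [(x)], for [x] in [S]. The
    factors of [(x)] that it yields are invertible, and the first is squeezed
    between [S] and its divisorial closure. *)
Lemma sharp_vclosure_invertible S : nonzero_ideal S ->
  cleared_invertible (vclosure S).
Proof.
move=> nS; have [iS _] := nS; have [x Sx x0] := nonzero_idealE nS.
have iP := principal_ideal x.
have sub : prod_ideal S (colon (principal x) S) `<=` principal x.
  by apply: prod_sub => // s z Ss zS; rewrite mulrC; exact: zS.
have colx : colon (principal x) S x by move=> s _; exists s; rewrite mulrC.
have [||A' [B' [iA' iB' SA' cB' xAB]]] := D_sharp _ nS _ sub.
- exact: (nonzero_idealI iP (principal_id x)).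
- exact: (nonzero_idealI (colon_ideal S iP) colx).
have invA' : cleared_invertible A' by exists B', x.
suff -> : vclosure S = A' by [].
apply/seteqP; split; first exact: vclosure_sub_invertible.
move=> a A'a c d d0 cS; have [x' cx] := cS _ Sx.
have B'x' : B' x'.
  apply: cB' => s Ss; have [s' cs] := cS _ Ss; exists s'.
  apply: (mulIf d0).
  have -> : x' * s * d = (x' * d) * s by ring.
  have -> : s' * x * d = (s' * d) * x by ring.
  by rewrite -cx -cs; ring.
have : principal x (a * x') by rewrite xAB; exact: prod_mem.
move=> [r ax']; exists r; apply: (mulIf x0).
have -> : c * a * x = a * (c * x) by ring.
by rewrite cx mulrA ax'; ring.
Qed.

(** Sharpness is applied to [(x, y)^2] inside [(x, y^2)]. In a factorization
    of [(x, y^2)] into ideals containing [(x, y)], one factor has an element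
    [a] dividing [x] and [y^2] locally at [M]. If [a] is in [M], then so is
    [w^2] up to a factor prime to [M]. Otherwise that factor is locally the
    unit ideal, the other one is [(x, y^2)] and contains [y], hence [x] divides
    [y] locally. *)
Lemma sharp_vclosure_pair M x y w : prime_ideal M -> x != 0 -> M x -> M y ->
  vclosure [set x; y] w -> M w.
Proof.
move=> pM x0 Mx My vw; have [iM nM1 pM'] := pM.
apply: contrapT => nMw.
have iI := pair_ideal_ideal x (y * y); have iA := pair_ideal_ideal x y.
have Ix := pair_ideal_l x (y * y); have Iyy := pair_ideal_r x (y * y).
have nA := nonzero_idealI iA (pair_ideal_l x y) x0.
have sub : prod_ideal (pair_ideal x y) (pair_ideal x y) `<=` pair_ideal x (y * y).
  apply: prod_sub => // _ _ [r [s ->]] [r' [s' ->]].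
  by exists (r * r' * x + r * s' * y + s * r' * y), (s * s'); ring.
have [A' [B' [iA' iB' AA' AB' IAB]]] :=
  D_sharp (nonzero_idealI iI Ix x0) nA nA sub.
have [a [t [ABa nMt tx tyy]]] := two_generated_factor pM iA' iB' (esym IAB).
have iPa := principal_ideal a; have iPx := principal_ideal x.
have [Ma|nMa] := pselect (M a).
- have a0 : a != 0.
    apply/eqP => a0; case: tx => r; rewrite a0 mulr0 => /eqP.
    rewrite mulf_eq0 (negbTE x0) orbF => /eqP t0.
    by apply: nMt; rewrite t0; exact: ideal0.
  have txw : principal a (t * x * w).
    by apply: vw => // s _; exact: idealMr.
  have tyw : principal a (t * y * w).
    apply: vw => // s [->|->]; last by rewrite -mulrA.
    by rewrite mulrAC; exact: idealMr.
  have [r tww] : principal a (t * w * w).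
    by apply: vw => // s [->|->]; rewrite mulrAC.
  apply: (prime_notinM pM (prime_notinM pM nMt nMw) nMw).
  by rewrite tww; exact: idealMl.
- have [r [s ay]] : pair_ideal x (y * y) (a * y).
    have [A'y B'y] : A' y /\ B' y.
      by split; [apply: AA'|apply: AB']; exact: pair_ideal_r.
    rewrite IAB.
    by case: ABa => ?; [|rewrite mulrC]; exact: prod_mem.
  have nMas : ~ M (a - s * y).
    move=> Mas; apply: nMa; have -> : a = (a - s * y) + s * y by ring.
    by apply: idealD => //; exact: idealMl.
  have [u uw] : principal x ((a - s * y) * w).
    apply: vw => // z [->|->]; first by apply: idealMl => //; exact: principal_id.
    by exists r; rewrite mulrBl ay; ring.
  by apply: (prime_notinM pM nMas nMw); rewrite uw; exact: idealMl.
Qed.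

(** The divisorial closure of [C + (m)] stays inside [M] because [C] is locally
    generated by one element, which reduces it to the closure of a pair. *)
Lemma invertible_enlarge M C m : prime_ideal M -> cleared_invertible C ->
  C `<=` M -> M m ->
  exists E G, [/\ cleared_invertible E, cleared_invertible G,
    C = prod_ideal E G, E `<=` M & E m].
Proof.
move=> pM invC CM Mm; have [iM _ pM'] := pM; have iC := invertible_is_ideal invC.
have [c [s [Cc nMs sC]]] := invertible_locally_principal pM invC.
have [z Cz z0] := nonzero_idealE (invertible_nonzero invC).
have s0 : s != 0 by apply/eqP => s0; apply: nMs; rewrite s0; exact: ideal0.
have c0 : c != 0.
  apply/eqP => c0; have [r /eqP] := sC z Cz.
  by rewrite c0 mulr0 mulf_eq0 (negbTE s0) (negbTE z0).
pose S : set D := [set u | exists v r, C v /\ u = v + r * m].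
have iS : is_ideal S.
  split.
  - by exists 0, 0; split; [exact: ideal0|ring].
  - move=> _ _ [v [r [Cv ->]]] [v' [r' [Cv' ->]]]; exists (v + v'), (r + r').
    by split; [exact: idealD|ring].
  - move=> a _ [v [r [Cv ->]]]; exists (a * v), (a * r).
    by split; [exact: idealMl|ring].
have CS : C `<=` S by move=> v Cv; exists v, 0; split=> //; ring.
have Sm : S m by exists 0, 1; split; [exact: ideal0|ring].
have invE := sharp_vclosure_invertible (nonzero_idealI iS (CS _ Cz) z0).
have CE : C `<=` vclosure S by move=> v /CS; exact: sub_vclosure.
exists (vclosure S), (colon C (vclosure S)).
have CEG := prod_colon invE iC CE.
split=> //; last exact: sub_vclosure.
  apply: (invertible_factor (vclosure_ideal S)); first exact: colon_ideal.
  by rewrite -CEG.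
move=> w Sw; suff /pM' [] : M (s * w) by [].
apply: (sharp_vclosure_pair pM c0 (CM _ Cc) Mm) => e d d0 ecm.
have iP := principal_ideal d.
have ec : principal d (e * c) by apply: ecm; left.
have em : principal d (e * m) by apply: ecm; right.
rewrite mulrA; apply: Sw => // _ [v [r [Cv ->]]].
have [k sv] := sC v Cv.
have -> : e * s * (v + r * m) = e * (s * v) + s * r * (e * m) by ring.
rewrite sv mulrCA; apply: idealD => //; exact: idealMl.
Qed.

(** In additive terms a positive element of the group of invertible ideals is
    split as [e + g] with [g] not above [e], so that the translates by [0] and
    by [g] of the interval from [0] to [e] are disjoint. Density of [M]
    provides elements of [M] outside any given proper invertible ideal; the
    first enlargement makes [G] proper, and a second one adds to [E] an element
    outside [G]. *)
Lemma dense_prime_split M C : prime_ideal M -> vclosure M 1 ->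
  cleared_invertible C -> C `<=` M ->
  exists E G, [/\ cleared_invertible E, cleared_invertible G,
    C = prod_ideal E G, E `<=` M & ~ E `<=` G].
Proof.
move=> pM dM invC CM; have [_ nM1 _] := pM.
have escape V : cleared_invertible V -> ~ V 1 -> exists2 m, M m & ~ V m.
  move=> invV nV1; apply: contrapT => nm; apply: nV1.
  apply: (vclosure_sub_invertible invV) dM => m Mm.
  by apply: contrapT => nVm; apply: nm; exists m.
have [m Mm nCm] := escape C invC (fun h => nM1 (CM _ h)).
have [E0 [G0 [invE0 invG0 CEG0 E0M E0m]]] := invertible_enlarge pM invC CM Mm.
have [m' Mm' nG0m'] : exists2 m', M m' & ~ G0 m'.
  apply: escape => // G01; apply: nCm.
  by rewrite CEG0 -(mulr1 m); exact: prod_mem.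
have [E [H [invE invH E0EH EM Em']]] := invertible_enlarge pM invE0 E0M Mm'.
have iE := invertible_is_ideal invE; have iH := invertible_is_ideal invH.
have iG0 := invertible_is_ideal invG0.
exists E, (prod_ideal H G0); split=> //.
- exact: invertible_prod.
- by rewrite prod_idealA // -E0EH.
- by move=> /(_ m' Em') /(prod_subr iG0).
Qed.

(** An invertible ideal is generated by finitely many elements. *)
Lemma countable_invertible : countable [set: D] ->
  exists L : nat -> set D, forall V, cleared_invertible V -> exists n, V = L n.
Proof.
move=> /countable_injP [f finj].
pose span (s : seq D) : set D :=
  [set z | exists r : nat -> D, z = \sum_(i < size s) r i * s`_i].
exists (fun n => [set z | exists2 s, pickle (map f s) = n & span s z]).
move=> V [B [d [iV iB d0 VB]]].
have [n [a [b [Va Bb dE]]]] : prod_ideal V B d.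
  by rewrite VB; exact: principal_id.
pose s := [seq a i | i <- enum 'I_n].
have ss : size s = n by rewrite size_map size_enum_ord.
have sE (i : 'I_n) : s`_i = a i.
  by rewrite (nth_map i) ?size_enum_ord // nth_ord_enum.
exists (pickle (map f s)); apply/seteqP; split=> z.
- move=> Vz; exists s => //.
  have /choice [r zb] : forall i, exists r, z * b i = r * d.
    by move=> i; apply: (inverse_over_mem _ Vz (Bb i)).
  exists (fun i => if insub i is Some j then r j else 0); rewrite ss.
  apply: (mulIf d0); rewrite {1}dE mulr_sumr mulr_suml.
  apply: eq_bigr => i _; rewrite sE valK mulrCA zb; ring.
- move=> [s' /(pcan_inj pickleK)] /inj_map s's [r ->].
  have -> : s' = s by apply: s's => x y; apply: finj; rewrite inE.
  rewrite ss; apply: ideal_sum => // i; rewrite sE.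
  exact: idealMl.
Qed.

(** Cantor's nested intervals, in the set of invertible ideals ordered by
    inclusion: the interval from [B C] to [B] with [C] inside [M] contains two
    disjoint intervals of the same kind, from [B E] to [B] and from [B C] to
    [B G], at least one of which misses a prescribed ideal. *)
Lemma no_dense_prime M x : countable [set: D] -> prime_ideal M ->
  M x -> x != 0 -> ~ vclosure M 1.
Proof.
move=> cD pM Mx x0 dM; have [iM _ _] := pM.
have [L Lsurj] := countable_invertible cD.
pose good (st : set D * set D) := [/\ cleared_invertible st.1,
  cleared_invertible st.2, st.2 `<=` M & prod_ideal st.1 st.2 x].
pose next n (st st' : set D * set D) := [/\ st'.1 `<=` st.1,
  prod_ideal st.1 st.2 `<=` prod_ideal st'.1 st'.2 &
  ~ (prod_ideal st'.1 st'.2 `<=` L n /\ L n `<=` st'.1)].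
have step n (st : {st | good st}) : exists st' : {st | good st}, next n (sval st) (sval st').
  case: st => -[B C] [/= invB invC CM BCx].
  have [E [G [invE invG CEG EM nEG]]] := dense_prime_split pM dM invC CM.
  have iB := invertible_is_ideal invB; have iE := invertible_is_ideal invE.
  have iG := invertible_is_ideal invG.
  have BGE : prod_ideal (prod_ideal B G) E = prod_ideal B C.
    by rewrite -prod_idealA // CEG (prod_idealC G).
  have [BEL|nBEL] := pselect (prod_ideal B E `<=` L n).
  - have gd : good (prod_ideal B G, E).
      by split=> //=; [exact: invertible_prod|rewrite BGE].
    exists (exist _ _ gd); split=> /=.
    + exact: prod_subl.
    + by rewrite BGE.
    + move=> [_ LBG]; apply: nEG; apply: (invertible_cancel invB iG).
      exact: subset_trans LBG.
  - have BCBE : prod_ideal B C `<=` prod_ideal B E.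
      apply: prod_mono => //; rewrite CEG; exact: prod_subl.
    have gd : good (B, E) by split=> //=; exact: BCBE.
    by exists (exist _ _ gd); split=> //= -[].
have /choice [nx nxP] : forall nst : nat * {st | good st},
    exists st' : {st | good st},
    next nst.1 (sval nst.2) (sval st').
  by case=> n st; exact: step.
have gd0 : good (setT, principal x).
  split=> /=; [exact: invertible_setT|exact: invertible_principal| |].
    by move=> _ [r ->]; exact: idealMl.
  by rewrite -(mul1r x); apply: prod_mem => //; rewrite mul1r; exact: principal_id.
pose u := fix u n := if n is k.+1 then nx (k, u k) else exist good _ gd0.
pose hi n := (sval (u n)).1; pose lo n := prod_ideal (hi n) (sval (u n)).2.
have uP n : next n (sval (u n)) (sval (u n.+1)) by exact: (nxP (n, u n)).
have ugood n : good (sval (u n)) by case: (u n).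
have hi_inv n : cleared_invertible (hi n) by case: (ugood n).
have lohi n : lo n `<=` hi n by apply: prod_subl; exact: invertible_is_ideal.
have hiS n k : hi (n + k)%N `<=` hi n.
  elim: k => [|k IH]; first by rewrite addn0.
  by rewrite addnS; apply: subset_trans IH; case: (uP (n + k)%N).
have loS n k : lo n `<=` lo (n + k)%N.
  elim: k => [|k IH]; first by rewrite addn0.
  by rewrite addnS; apply: (subset_trans IH); case: (uP (n + k)%N).
have lo_sub n k : lo n `<=` hi k.
  have [nk|/ltnW kn] := leqP n k.
    by rewrite -(subnKC nk); apply: subset_trans (lohi _); exact: loS.
  by apply: (subset_trans (lohi n)); rewrite -(subnKC kn); exact: hiS.
pose I : set D := \bigcap_n hi n.
have iI : is_ideal I.
  have iH n : is_ideal (hi n) by exact: invertible_is_ideal.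
  split.
  - by move=> n _; exact: ideal0.
  - by move=> a b Ia Ib n _; apply: idealD => //; [exact: Ia|exact: Ib].
  - by move=> a b Ib n _; apply: idealMl => //; exact: Ib.
have Ix : I x by move=> n _; apply: (lohi n); case: (ugood n).
have vI : vclosure I = I.
  apply/seteqP; split; last exact: sub_vclosure.
  move=> a Ia n _; apply: vclosure_sub_invertible Ia => // b; exact.
have [n In] : exists n, I = L n.
  by apply: Lsurj; rewrite -vI; exact: sharp_vclosure_invertible (nonzero_idealI iI Ix x0).
have [_ _] := uP n; apply; rewrite -In; split.
- by move=> a an k _; exact: (lo_sub n.+1).
- by move=> a; exact.
Qed.

(** With [V] the divisorial closure of [I], the ideal [J = I V^-1] is
    divisorially dense. A prime ideal containing [J] would be dense, so [J] is
    the unit ideal and [I = V]. *)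
Lemma countable_sharp_invertible I : countable [set: D] -> nonzero_ideal I ->
  cleared_invertible I.
Proof.
move=> cD nI; have [iI _] := nI; have [x Ix x0] := nonzero_idealE nI.
have invV := sharp_vclosure_invertible nI.
have iJ := colon_ideal (vclosure I) iI.
set J := colon I (vclosure I) in iJ.
have IVJ : I = prod_ideal (vclosure I) J.
  by apply: prod_colon => //; exact: sub_vclosure.
have dJ : vclosure J 1.
  move=> c d d0 cJ; rewrite mulr1.
  have [B [e VB]] := invV; have [iV iB e0 _] := VB.
  have iP := principal_ideal d.
  apply: (inverse_over_elim VB iP) => v b Vv Bb.
  have [r cbv] : principal (d * e) (c * b * v).
    have iX := colon_ideal [set c * b] (principal_ideal (d * e)).
    have sub : I `<=` colon (principal (d * e)) [set c * b].
      rewrite {1}IVJ; apply: prod_sub => //.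
      move=> v' z Vv' /cJ [r cz] _ ->.
      have [k vb] := inverse_over_mem VB Vv' Bb; exists (k * r).
      have -> : v' * z * (c * b) = (v' * b) * (c * z) by ring.
      by rewrite vb cz; ring.
    apply: Vv => [|i Ii]; first exact: mulf_neq0.
    by rewrite [c * b * i]mulrC; exact: sub.
  exists (r * d); first by exists r.
  by rewrite mulrCA mulrA -mulrA (mulrC v) mulrA cbv; ring.
have [J1|nJ1] := pselect (J 1).
  suff -> : I = vclosure I by [].
  apply/seteqP; split; first exact: sub_vclosure.
  by move=> v Vv; have := J1 v Vv; rewrite mul1r.
have [M pM JM] := ideal_in_prime iJ nJ1.
have Mx : M x.
  by apply: JM => v _; rewrite mulrC; exact: idealMl.
by have [] := no_dense_prime cD pM Mx x0 (vclosure_mono JM dJ).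
Qed.

End Sharp.

End Ideals.

Theorem corollary17 (D : idomainType)
    (D_countable : countable [set: D]%classic)
    (D_sharp : sharp_domain D) :
  dedekind_domain D.
Proof.
move=> I nI; apply: cleared_invertibleI.
exact: countable_sharp_invertible.
Qed.
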